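(* Let $N=\{1,\dots,n\}$ ($n\ge1$) be a set of agents and $M$ a finite set of indivisible goods. Suppose every agent $i\in N$ has a normalized, monotone valuation $v_i:2^M\to\mathbb{R}_{\ge 0}$ that is both subadditive and leveled. Then there exists a complete allocation $A=(A_1,\dots,A_n)\in\Pi_n(M)$ that is $1/2$-MMS, i.e. $v_i(A_i)\ge \tfrac12\,\mu_i^n(M)$ for every $i\in N$.
   Context: A valuation $v:2^M\to\mathbb{R}_{\ge0}$ is normalized if $v(\emptyset)=0$, monotone if $v(S)\le v(T)$ whenever $S\subseteq T$, leveled if $v(S)>v(T)$ for all $S,T\subseteq M$ with $|S|>|T|$, and subadditive if $v(S)+v(T)\ge v(S\cup T)$ for all $S,T\subseteq M$. $\Pi_n(M)$ is the set of all tuples $(A_1,\dots,A_n)$ of pairwise disjoint (possibly empty) subsets of $M$ whose union is $M$. The maximin share of agent $i$ is $\mu_i^n(M)=\max_{A\in\Pi_n(M)}\min_{k\in\{1,\dots,n\}} v_i(A_k)$. *)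

(* Defs.v *)
From mathcomp Require Import all_boot all_order all_algebra.
From mathcomp Require Import reals.

Set Implicit Arguments.
Unset Strict Implicit.
Unset Printing Implicit Defensive.

Import Order.TTheory GRing.Theory Num.Theory.
Local Open Scope ring_scope.

(* The set of goods is the whole finite type [M]; the agents, and the bundles
   of an allocation, are indexed by ['I_n.+1], so that there is always at
   least one of them. *)

Section Valuations.
Variables (R : realType) (M : finType).
Implicit Types (v : {set M} -> R) (S T : {set M}).

Definition nonnegative v := forall S, 0 <= v S.

Definition normalized v := v set0 = 0.

Definition monotone v := forall S T, S \subset T -> v S <= v T.

Definition leveled v := forall S T, (#|T| < #|S|)%N -> v T < v S.

Definition subadditive v := forall S T, v (S :|: T) <= v S + v T.

End Valuations.

Section Allocations.
Variables (n : nat) (M : finType).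

Definition allocations : {set {ffun 'I_n.+1 -> {set M}}} :=
  [set A : {ffun 'I_n.+1 -> {set M}} |
    [forall i, forall j, (i != j) ==> [disjoint A i & A j]]
    && (\bigcup_i A i == [set: M])].

Definition all_to_first : {ffun 'I_n.+1 -> {set M}} :=
  [ffun i => if i == ord0 then [set: M] else set0].

Lemma all_to_first_alloc : all_to_first \in allocations.
Proof.
rewrite inE; apply/andP; split.
  apply/forallP => i; apply/forallP => j; apply/implyP => ij; rewrite !ffunE.
  case: eqP => [i0|_]; last by rewrite -setI_eq0 set0I.
  case: eqP => [j0|_]; last by rewrite -setI_eq0 setI0.
  by rewrite i0 j0 eqxx in ij.
rewrite eqEsubset subsetT /=; apply/subsetP => x _.
by apply/bigcupP; exists ord0; rewrite // ffunE eqxx inE.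
Qed.

End Allocations.

Section MaximinShare.
Variables (R : realType) (n : nat) (M : finType).
Implicit Types (v : {set M} -> R) (A : {ffun 'I_n.+1 -> {set M}}).

(* [R] has neither a top nor a bottom element, so the iterated minimum and
   maximum below start from a value that is already in their range. *)
Definition min_bundle v A : R :=
  \big[Num.min/v (A ord0)]_(k < n.+1) v (A k).

Definition mms v : R :=
  \big[Num.max/min_bundle v (all_to_first n M)]_(A in allocations n M)
    min_bundle v A.

Lemma min_bundle_le v A k : min_bundle v A <= v (A k).
Proof. exact: bigmin_le_cond. Qed.

Lemma min_bundle_attained v A : exists k, min_bundle v A = v (A k).
Proof.
rewrite /min_bundle; apply: (big_ind (fun x => exists k, x = v (A k))).
- by exists ord0.
- by move=> x y [i ->] [j ->]; case: leP => _; [exists i | exists j].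
- by move=> k _; exists k.
Qed.

Lemma mms_ge v A : A \in allocations n M -> min_bundle v A <= mms v.
Proof. exact: le_bigmax_cond. Qed.

Lemma mms_attained v :
  exists2 A, A \in allocations n M & mms v = min_bundle v A.
Proof.
rewrite /mms; apply: (big_ind (fun x =>
  exists2 A, A \in allocations n M & x = min_bundle v A)).
- by exists (all_to_first n M) => //; exact: all_to_first_alloc.
- by move=> x y [A ? ->] [B ? ->]; case: leP => _; [exists B | exists A].
- by move=> A ?; exists A.
Qed.

Definition approx_MMS (alpha : R) (v : 'I_n.+1 -> {set M} -> R) A :=
  forall i, alpha * mms (v i) <= v i (A i).

End MaximinShare.

Arguments mms {R} n {M} v.

(* Main.v *)
Require Import Defs.
From mathcomp Require Import all_boot all_order all_algebra.
From mathcomp Require Import reals.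
From mathcomp Require Import zify lra.
Local Open Scope ring_scope.

Set Implicit Arguments.
Unset Strict Implicit.
Unset Printing Implicit Defensive.

(** Write |M| = q N + r with r < N, where N is the number of agents, and
    k = N - r. The last r agents receive q + 1 goods each: every partition has
    a bundle of at most q goods, so by leveledness they get more than their
    maximin share. The first k agents receive q goods each. If q <> 1, halving
    a bundle of at most q goods leaves two parts that are smaller than q (or
    empty), so every set of q goods is worth half the maximin share. If q = 1,
    an agent whose maximin share exceeds the value of every good of a set F
    has a maximin partition where every bundle A satisfies
    |A| + |A \ F| >= 2, which is impossible while fewer than k goods are gone;
    so the first k agents can successively pick a good worth their full
    share. *)

Import Order.TTheory GRing.Theory Num.Theory.

Lemma exists_subset_card (M : finType) (F : {set M}) (k : nat) :
  (k <= #|F|)%N -> exists2 S : {set M}, S \subset F & #|S| = k.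
Proof.
move=> kF; exists [set x in take k (enum F)].
  by apply/subsetP => x; rewrite inE => /mem_take; rewrite mem_enum.
rewrite cardsE (card_uniqP _) ?take_uniq ?enum_uniq // size_takel //.
by rewrite -cardE.
Qed.

(** Agents are served in index order. [c t] is the number of goods gone after [t] turns, so [F]
    stands for the goods still free at the turn of agent [i], and [c n.+1 = #|M|] makes the
    allocation complete. *)
Lemma greedy_allocation (n : nat) (M : finType)
    (P : 'I_n.+1 -> {set M} -> Prop) (c : nat -> nat) :
  c 0 = 0%N -> c n.+1 = #|M| ->
  (forall (i : 'I_n.+1) (F : {set M}), (#|F| + c i)%N = #|M| ->
     exists2 S : {set M}, S \subset F & P i S /\ (#|S| + c i)%N = c i.+1) ->
  exists2 A, A \in allocations n M & forall i, P i (A i).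
Proof.
move=> c0 cn pick.
(* Agents not yet served hold [set0], so giving [S] to agent [t] only adds [S] to the union. *)
have step t : (t <= n.+1)%N -> exists A : {ffun 'I_n.+1 -> {set M}},
    [/\ forall i : 'I_n.+1, (i < t)%N -> P i (A i),
        forall i : 'I_n.+1, (t <= i)%N -> A i = set0,
        forall i j, i != j -> [disjoint A i & A j]
      & #|\bigcup_i A i| = c t].
  elim: t => [_|t IH ltn].
    exists [ffun=> set0]; split=> // [i _|i j _|].
    - by rewrite ffunE.
    - by rewrite !ffunE -setI_eq0 setI0.
    - by rewrite big1 ?cards0 // => i _; rewrite ffunE.
  have [A [AP A0 Adisj Ac]] := IH (ltnW ltn).
  pose i0 := Ordinal ltn; pose U := \bigcup_i A i.
  have [|S SF [PS cS]] := pick i0 (~: U).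
    by rewrite /= -Ac addnC cardsC.
  have SU : [disjoint S & U] by rewrite disjoints_subset.
  have disjS j : [disjoint S & A j].
    by apply: disjointWr SU; exact: bigcup_sup.
  exists [ffun j => if j == i0 then S else A j]; split.
  - move=> i; rewrite ltnS leq_eqVlt ffunE; have [-> //|ne] := eqVneq i i0.
    case/orP => [it|/AP //].
    by rewrite -val_eqE /= it in ne.
  - move=> i ti; rewrite ffunE ifF ?A0 1?ltnW //.
    by apply/negP => /eqP ei; rewrite ei /= ltnn in ti.
  - move=> i j ij; rewrite !ffunE.
    case: eqP => [ei|_]; case: eqP => [ej|_] //.
    + by rewrite ei ej eqxx in ij.
    + by rewrite disjoint_sym.
    + exact: Adisj.
  - have -> : \bigcup_i [ffun j => if j == i0 then S else A j] i = S :|: U.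
      rewrite /U (bigD1 i0) // [in RHS](bigD1 i0) //= ffunE eqxx A0 // set0U.
      by congr (_ :|: _); apply: eq_bigr => j /negPf ne; rewrite ffunE ne.
    by move: SU; rewrite -setI_eq0 => /eqP SU; rewrite cardsU SU cards0 subn0 Ac.
have [A [AP _ Adisj Ac]] := step _ (leqnn n.+1).
exists A => [|i]; last exact: AP.
rewrite inE; apply/andP; split.
  by apply/forallP => i; apply/forallP => j; apply/implyP; exact: Adisj.
by rewrite eqEcard subsetT cardsT Ac cn leqnn.
Qed.

(** Double counting: each good of [X] lies in exactly one bundle. *)
Lemma sum_card_allocation (n : nat) (M : finType)
    (A : {ffun 'I_n.+1 -> {set M}}) (X : {set M}) :
  A \in allocations n M -> (\sum_i #|A i :&: X|)%N = #|X|.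
Proof.
rewrite inE => /andP[/forallP Adisj /eqP Acov].
have card1 (i : 'I_n.+1) : #|A i :&: X| = (\sum_(x in X) (x \in A i))%N.
  rewrite -sum1_card big_mkcond [RHS]big_mkcond; apply: eq_bigr => x _.
  by rewrite inE; case: (x \in A i); case: (x \in X).
under eq_bigr do rewrite card1.
rewrite exchange_big /= -sum1_card; apply: eq_bigr => x _.
have /bigcupP[i _ xi] : x \in \bigcup_i A i by rewrite Acov inE.
rewrite (bigD1 i) //= xi big1 // => j ji.
have /forallP/(_ i)/implyP/(_ ji) := Adisj j.
by rewrite disjoint_sym => /disjointFr -> //.
Qed.

Lemma exists_small_bundle (n : nat) (M : finType)
    (A : {ffun 'I_n.+1 -> {set M}}) :
  A \in allocations n M -> exists i, (#|A i| <= #|M| %/ n.+1)%N.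
Proof.
move=> Aall; apply/existsP; apply: contraT; rewrite negb_exists.
move=> /forallP big.
have := sum_card_allocation [set: M] Aall; rewrite cardsT => sumA.
have : (\sum_(i < n.+1) (#|M| %/ n.+1).+1 <= #|M|)%N.
  by rewrite -[leqRHS]sumA; apply: leq_sum => i _; rewrite setIT ltnNge.
by rewrite sum_nat_const card_ord mulnC leqNgt ltn_ceil.
Qed.

Section OneAgent.
Variables (R : realType) (n : nat) (M : finType) (v : {set M} -> R).
Hypothesis v_lev : leveled v.
Local Notation q := (#|M| %/ n.+1)%N.
Local Notation mu := (mms n v).

Lemma mms_le_small_bundle :
  exists2 B : {set M}, (#|B| <= q)%N & mu <= v B.
Proof.
have [A Aall ->] := mms_attained n v.
by have [i Ai] := exists_small_bundle Aall; exists (A i); rewrite ?min_bundle_le.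
Qed.

Lemma mms_lt_large (S : {set M}) : (q < #|S|)%N -> mu < v S.
Proof.
move=> qS; have [B Bq muB] := mms_le_small_bundle.
by apply: (le_lt_trans muB); apply: v_lev; apply: leq_ltn_trans qS.
Qed.

Lemma mms_ge0 : nonnegative v -> 0 <= mu.
Proof.
move=> v0; have [A _ ->] := mms_attained n v.
by have [k ->] := min_bundle_attained v A.
Qed.

Lemma half_mms_le_quotient (S : {set M}) :
  nonnegative v -> normalized v -> subadditive v ->
  q != 1%N -> #|S| = q -> 1 / 2 * mu <= v S.
Proof.
move=> v0 vn vsub q1 Sq; have [B Bq muB] := mms_le_small_bundle.
(* If [q = 0], then [B] is empty and the share is at most 0. *)
have [q0|q_gt0] := posnP q.
  move: Bq; rewrite q0 leqn0 cards_eq0 => /eqP B0.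
  by move: muB (v0 S); rewrite B0 vn; lra.
(* The larger part has at most ceil(q/2) goods, fewer than q since now q >= 2. *)
have [B1 B1B cB1] := @exists_subset_card _ B (#|B| %/ 2) ltac:(lia).
have lt1 : v B1 < v S by apply: v_lev; lia.
have lt2 : v (B :\: B1) < v S.
  by apply: v_lev; rewrite cardsD (setIidPr B1B); lia.
have := vsub B1 (B :\: B1).
have -> : B1 :|: B :\: B1 = B by rewrite -{1}(setIidPr B1B) setID.
lra.
Qed.

Lemma mms_le_good (F : {set M}) :
  (0 < #|F|)%N -> (#|M| + #|~: F| < 2 * n.+1)%N ->
  exists2 x, x \in F & mu <= v [set x].
Proof.
move=> /card_gt0P[y yF] ltM; have [A Aall muA] := mms_attained n v.
apply/exists_inP; apply: contraLR ltM; rewrite negb_exists_in -leqNgt.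
move=> /forall_inP noG.
have ltA x i : x \in F -> v [set x] < v (A i).
  move=> xF; apply: (lt_le_trans (y := mu)); first by rewrite ltNge noG.
  by rewrite muA min_bundle_le.
(* Both cardinals are split over the bundles, so it is enough that each bundle contributes at least
   2. *)
rewrite -[#|M|]cardsT -!(sum_card_allocation _ Aall) -big_split /=.
rewrite mulnC -[in leqLHS](card_ord n.+1) -sum_nat_const.
apply: leq_sum => i _; rewrite setIT.
(* By leveledness an empty bundle would be worth less than the good [y] of [F]. *)
have Ai_gt0 : (0 < #|A i|)%N.
  rewrite lt0n; apply/eqP => Ai0; have := ltA y i yF.
  by rewrite ltNge ltW // v_lev // Ai0 cards1.
have [Ai1|Ai2] := ltnP #|A i| 2; last by rewrite (leq_trans Ai2) ?leq_addr.
have /cards1P[x Ax] : #|A i| == 1%N by lia.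
have xF : x \notin F by apply/negP => /(ltA x i); rewrite Ax ltxx.
have /setIidPl -> : A i \subset ~: F by rewrite Ax sub1set inE.
by rewrite Ax cards1.
Qed.

End OneAgent.

Theorem theorem3 (R : realType) (n : nat) (M : finType)
    (v : 'I_n.+1 -> {set M} -> R)
    (v_nonneg : forall i, nonnegative (v i))
    (v_norm : forall i, normalized (v i))
    (v_mono : forall i, monotone (v i))
    (v_sub : forall i, subadditive (v i))
    (v_lev : forall i, leveled (v i)) :
  exists A : {ffun 'I_n.+1 -> {set M}},
    A \in allocations n M /\ approx_MMS (1 / 2) v A.
Proof.
pose q := (#|M| %/ n.+1)%N; pose r := (#|M| %% n.+1)%N.
have Mqr : #|M| = (q * n.+1 + r)%N := divn_eq _ _.
have r_lt : (r < n.+1)%N by rewrite ltn_mod.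
(* The truncated subtraction counts those of the first [t] agents that receive [q.+1] goods: the
   ones of index at least [n.+1 - r]. *)
pose c t := (t * q + (t - (n.+1 - r)))%N.
suff [A Aall AP] : exists2 A, A \in allocations n M &
    forall i, 1 / 2 * mms n (v i) <= v i (A i) by exists A.
apply: (@greedy_allocation _ _ (fun i S => 1 / 2 * mms n (v i) <= v i S) c)
  => [||i F FM].
- by rewrite /c mul0n.
- by rewrite /c Mqr; lia.
have i_lt := ltn_ord i.
have mu0 := mms_ge0 n (v_nonneg i).
have cS : c i.+1 = (q + (n.+1 - r <= i) + c i)%N.
  rewrite /c mulSn; case: leqP => ?; lia.
(* Together with [cS], this ensures that [F] has enough goods for the bundle of agent [i]. *)
have cF : (c i.+1 <= #|M|)%N.
  rewrite Mqr /c.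
  have : (i.+1 * q <= n.+1 * q)%N by rewrite leq_mul2r i_lt orbT.
  lia.
have [i_large|i_small] := leqP (n.+1 - r) i.
  have [S SF cardS] := @exists_subset_card _ F q.+1 ltac:(lia).
  exists S => //; split; last by lia.
  have : mms n (v i) < v i S by apply: mms_lt_large => //; rewrite cardS.
  lra.
have [q1|q1] := eqVneq q 1%N; last first.
  have [S SF cardS] := @exists_subset_card _ F q ltac:(lia).
  exists S => //; split; last by lia.
  exact: half_mms_le_quotient.
have ci : c i = i by rewrite /c; lia.
have cC : (#|F| + #|~: F|)%N = #|M| by rewrite cardsC.
(* With N agents, |M| = N + r and [i] goods are gone, so the sum to bound is N + r + i, below 2N
   because i < N - r. *)
have [||x xF mux] := @mms_le_good R n M (v i) (v_lev i) F; [lia|lia|].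
exists [set x]; rewrite ?sub1set ?cards1 //; split; last by lia.
by lra.
Qed.
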